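(* Let $G$ and $H$ be two cers. If $G$ and $H$ are resonantly equivalent, then the resonance graph $R(G)$ is isomorphic to the resonance graph $R(H)$.
   Context: An even ring system is a simple bipartite 2-connected plane graph in which all interior vertices have degree 3 and all boundary vertices have degree 2 or 3. The inner dual has a vertex for each inner face, two vertices adjacent iff the faces share an edge. A cers (catacondensed even ring system) is an even ring system whose inner dual is a tree. The resonance graph $R(G)$ of a cers $G$ has as vertices the perfect matchings of $G$, two perfect matchings $M_1,M_2$ being adjacent iff their symmetric difference $M_1\oplus M_2$ is exactly the edge set of one inner face of $G$. If $F$ is an inner face and $F_0$ the outer face of $G$, a connected component of the subgraph induced by $E(F)\cap E(F_0)$ is called a boundary segment. Transformation 1: given a cers $G$ and a boundary segment $P$, obtain a cers $G'$ by subdividing edges of $P$ an even number of times in total, or conversely by smoothing an even number of (degree-2) vertices of $P$. Two cers $G,H$ are resonantly equivalent if $G$ can be obtained from $H$ by successively applying Transformation 1. *)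

(* Defs.v *)
(* Plane graphs are encoded combinatorially, as rotation systems of
   genus 0 with a distinguished outer face. *)
From mathcomp Require Import all_boot.
From Stdlib Require Export Relation_Operators.

Set Implicit Arguments.
Unset Strict Implicit.
Unset Printing Implicit Defensive.

Record sgraph := SGraph {
  vertex :> finType;
  adj : rel vertex;
  adj_sym : symmetric adj;
  adj_irr : irreflexive adj }.

Section SimpleGraphs.
Variable G : sgraph.

Definition edges : {set {set G}} :=
  [set [set p.1; p.2] | p : G * G & adj p.1 p.2].

Definition degree (x : G) : nat := #|[set y | adj x y]|.

Definition connected : Prop := forall x y : G, connect (@adj G) x y.

Definition two_connected : Prop :=
  [/\ 2 < #|G|, connected &
      forall x y z : G, y != x -> z != x ->
        connect [rel a b | [&& adj a b, a != x & b != x]] y z].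

Definition bipartite : Prop :=
  exists c : G -> bool, forall x y : G, adj x y -> c x != c y.

Definition is_tree : Prop :=
  [/\ 0 < #|G|, connected &
      forall s : seq G, ucycle (@adj G) s -> size s <= 2].

Definition perfect_matching (M : {set {set G}}) : bool :=
  (M \subset edges) && [forall x : G, #|[set e in M | x \in e]| == 1].

End SimpleGraphs.

Definition isomorphic (G H : sgraph) : Prop :=
  exists2 f : G -> H, bijective f & forall x y : G, adj (f x) (f y) = adj x y.

(* [rot v] is the cyclic order of the neighbours of [v]: each neighbour of [v]
   is reached from any other by iterating [rot v]. Its values off the
   neighbourhood of [v] are irrelevant. A dart is a pair [(x, y)] with
   [adj x y]; [outer_dart] is any dart of the outer face. *)
Record embedded_graph := EmbeddedGraph {
  skeleton :> sgraph;
  rot : skeleton -> skeleton -> skeleton;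
  rot_adj : forall v x, adj v x -> adj v (rot v x);
  rot_cyclic : forall v x y, adj v x -> adj v y -> fconnect (rot v) x y;
  outer_dart : skeleton * skeleton;
  outer_dart_adj : adj outer_dart.1 outer_dart.2 }.

Section Faces.
Variable G : embedded_graph.

Definition next_dart (d : G * G) : G * G := (d.2, rot d.2 d.1).

Definition face_of (d : G * G) : {set G * G} :=
  [set d' | fconnect next_dart d d'].

Definition faces : {set {set G * G}} :=
  [set face_of d | d : G * G & adj d.1 d.2].

Definition outer_face : {set G * G} := face_of (outer_dart G).

Definition inner_faces : {set {set G * G}} := faces :\ outer_face.

Definition face_edges (F : {set G * G}) : {set {set G}} :=
  [set [set d.1; d.2] | d in F].

(* Euler's formula says that a connected rotation system has genus 0. *)
Definition plane : Prop :=
  connected G /\ #|G| + #|faces| = #|edges G| + 2.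

Definition boundary_vertex (x : G) : bool := [exists d in outer_face, d.1 == x].

Definition even_ring_system : Prop :=
  [/\ plane, bipartite G, two_connected G,
      forall x : G, ~~ boundary_vertex x -> degree x = 3 &
      forall x : G, boundary_vertex x -> degree x = 2 \/ degree x = 3].

Definition inner_face : finType := {F : {set G * G} | F \in inner_faces}.

Definition inner_dual_adj : rel inner_face :=
  [rel F1 F2 | (F1 != F2) &&
     (face_edges (val F1) :&: face_edges (val F2) != set0)].

Lemma inner_dual_sym : symmetric inner_dual_adj.
Proof. by move=> F1 F2; rewrite /inner_dual_adj /= eq_sym setIC. Qed.

Lemma inner_dual_irr : irreflexive inner_dual_adj.
Proof. by move=> F; rewrite /inner_dual_adj /= eqxx. Qed.

Definition inner_dual : sgraph := SGraph inner_dual_sym inner_dual_irr.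

Definition cers : Prop := even_ring_system /\ is_tree inner_dual.

Definition pmatching : finType := {M : {set {set G}} | perfect_matching M}.

Definition symdiff (A B : {set {set G}}) : {set {set G}} :=
  (A :\: B) :|: (B :\: A).

Definition resonance_adj : rel pmatching :=
  [rel M1 M2 | [exists F in inner_faces,
     symdiff (val M1) (val M2) == face_edges F]].

Lemma resonance_sym : symmetric resonance_adj.
Proof. by move=> M1 M2; apply: eq_existsb => F; rewrite /symdiff setUC. Qed.

Lemma resonance_irr : irreflexive resonance_adj.
Proof.
move=> M; apply/existsP => -[F /andP[]].
rewrite inE => /andP[_ /imsetP[d _ ->]].
rewrite /symdiff setDv setUid eq_sym => /eqP /setP /(_ [set d.1; d.2]).
rewrite in_set0 => /negP; apply; apply/imsetP.
by exists d; rewrite // inE connect0.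
Qed.

Definition resonance_graph : sgraph := SGraph resonance_sym resonance_irr.

(* Edge set of the component containing [x] of the graph with edge set [S]. *)
Definition edge_component (S : {set {set G}}) (x : G) : {set {set G}} :=
  [set e in S | [exists y in e, connect [rel a b | [set a; b] \in S] x y]].

Definition boundary_segment (P : {set {set G}}) : Prop :=
  exists2 F, F \in inner_faces &
    let S := face_edges F :&: face_edges outer_face in
    exists2 x, x \in cover S & P = edge_component S x.

End Faces.

(* The edge [uv] is replaced by the path [Some u, None, Some v]. *)
Section Subdivision.
Variables (G : embedded_graph) (u v : G) (uv : adj u v).

Definition sub_adj : rel (option G) := fun a b =>
  match a, b with
  | Some x, Some y => adj x y && ([set x; y] != [set u; v])
  | Some x, None | None, Some x => x \in [set u; v]
  | None, None => false
  end.

Lemma sub_adj_sym : symmetric sub_adj.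
Proof. by move=> [x|] [y|] //=; rewrite adj_sym setUC. Qed.

Lemma sub_adj_irr : irreflexive sub_adj.
Proof. by move=> [x|] //=; rewrite adj_irr. Qed.

Definition sub_sgraph : sgraph := SGraph sub_adj_sym sub_adj_irr.

(* [sub_head x y] is the head of the dart that [(x, y)] becomes at [Some x];
   [sub_unhead x] inverts it on the neighbours of [x]. *)
Definition sub_head (x y : G) : option G :=
  if [set x; y] == [set u; v] then None else Some y.

Definition sub_unhead (x : G) (a : option G) : G :=
  if a is Some y then y else if x == u then v else u.

Definition sub_rot (a b : option G) : option G :=
  if a is Some x then sub_head x (rot x (sub_unhead x b))
  else if b == Some u then Some v else Some u.

Lemma sub_neq : u != v.
Proof. by apply: contraTneq uv => ->; rewrite adj_irr. Qed.

Lemma sub_edgeP x y :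
  reflect ((x = u /\ y = v) \/ (x = v /\ y = u)) ([set x; y] == [set u; v]).
Proof.
apply: (iffP eqP) => [E|[[-> ->]|[-> ->]] //]; last by rewrite setUC.
have: x \in [set u; v] by rewrite -E set21.
have: y \in [set u; v] by rewrite -E set22.
have: u \in [set x; y] by rewrite E set21.
have: v \in [set x; y] by rewrite E set22.
rewrite !in_set2 => /orP[]/eqP ? /orP[]/eqP ? /orP[]/eqP ? /orP[]/eqP ?;
  subst; by [left | right | move: sub_neq; rewrite eqxx].
Qed.

Lemma sub_headK x y : sub_unhead x (sub_head x y) = y.
Proof.
rewrite /sub_head; case: sub_edgeP => [[[-> ->]|[-> ->]]|//] /=.
  by rewrite eqxx.
by rewrite eq_sym (negbTE sub_neq).
Qed.

Lemma sub_head_adj x y : adj x y -> sub_adj (Some x) (sub_head x y).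
Proof.
move=> xy; rewrite /sub_head; case: ifP => [|/= ->]; last by rewrite xy.
by case/sub_edgeP => -[-> _]; rewrite /= in_set2 eqxx ?orbT.
Qed.

Lemma sub_adj_head x a : sub_adj (Some x) a ->
  exists2 y, adj x y & a = sub_head x y.
Proof.
case: a => [y /andP[xy ne]|]; first by exists y; rewrite // /sub_head (negbTE ne).
rewrite /= in_set2 => /orP[]/eqP->; [exists v | exists u] => //.
- by rewrite /sub_head eqxx.
- by rewrite adj_sym.
- by rewrite /sub_head setUC eqxx.
Qed.

Lemma sub_rot_adj a b : sub_adj a b -> sub_adj a (sub_rot a b).
Proof.
case: a => [x /sub_adj_head[y xy ->]|_]; last first.
  by rewrite /sub_rot; case: ifP; rewrite /= in_set2 eqxx ?orbT.
by rewrite [sub_rot _ _]/= sub_headK; apply/sub_head_adj/rot_adj.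
Qed.

Lemma sub_rot_cyclic a b c :
  sub_adj a b -> sub_adj a c -> fconnect (sub_rot a) b c.
Proof.
case: a => [x /sub_adj_head[y xy ->] /sub_adj_head[z xz ->]|]; last first.
  case: b c => [b|//] [c|//]; rewrite /= !in_set2.
  move=> /orP[]/eqP-> /orP[]/eqP->; rewrite ?connect0 // connect1 //=.
    by rewrite eqxx.
  by rewrite (inj_eq Some_inj) [v == u]eq_sym (negbTE sub_neq).
have /iter_findex <- := rot_cyclic xy xz.
elim: (findex _ _ _) => [|n IHn]; first exact: connect0.
apply: connect_trans IHn _; apply: connect1.
by rewrite /= sub_headK.
Qed.

Definition sub_outer : sub_sgraph * sub_sgraph :=
  (Some (outer_dart G).1, sub_head (outer_dart G).1 (outer_dart G).2).

Lemma sub_outer_adj : adj sub_outer.1 sub_outer.2.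
Proof. exact: sub_head_adj (outer_dart_adj G). Qed.

Definition subdivide : embedded_graph :=
  @EmbeddedGraph sub_sgraph sub_rot sub_rot_adj sub_rot_cyclic
    sub_outer sub_outer_adj.

(* The set of edges that [P] becomes when its edge [uv] is subdivided. *)
Definition sub_segment (P : {set {set G}}) : {set {set subdivide}} :=
  [set (@Some G) @: (e : {set G}) | e in P :\ [set u; v]]
    :|: [set [set Some u; None]; [set None; Some v]].

End Subdivision.

(* Combinatorial form of "some homeomorphism of the plane carries [G] to [H]";
   the two alternatives preserve, respectively reverse, the orientation. *)
Definition plane_isomorphic (G H : embedded_graph) : Prop :=
  exists f : G -> H,
  [/\ bijective f,
      forall x y : G, adj (f x) (f y) = adj x y &
      ((forall x y : G, adj x y -> rot (f x) (f y) = f (rot x y)) /\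
       (f (outer_dart G).1, f (outer_dart G).2) \in outer_face H)
   \/ ((forall x y : G, adj x y -> rot (f x) (f (rot x y)) = f y) /\
       (f (outer_dart G).2, f (outer_dart G).1) \in outer_face H)].

(* [subdivided P n H]: up to plane isomorphism, [H] arises from [G] by [n]
   successive subdivisions of edges of [P] (the pieces of a subdivided edge
   replacing it in [P]). *)
Inductive subdivided (G : embedded_graph) (P : {set {set G}}) :
    nat -> embedded_graph -> Prop :=
| Subdivided0 H : plane_isomorphic G H -> subdivided P 0 H
| SubdividedS n H (u v : G) (uv : adj u v) :
    [set u; v] \in P -> subdivided (sub_segment uv P) n H ->
    subdivided P n.+1 H.

Definition segment_subdivision (G H : embedded_graph) : Prop :=
  exists P : {set {set G}}, exists n : nat,
    [/\ boundary_segment P, ~~ odd n & subdivided P n H].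

(* Smoothing vertices of a boundary segment is the converse of subdividing
   edges of the resulting segment. *)
Definition transformation1 (G G' : embedded_graph) : Prop :=
  [/\ cers G, cers G' & segment_subdivision G G' \/ segment_subdivision G' G].

Definition resonantly_equivalent (G H : embedded_graph) : Prop :=
  clos_refl_trans embedded_graph transformation1 H G.

(* Main.v *)
Require Import Defs.
From mathcomp Require Import all_boot all_algebra.

Set Implicit Arguments.
Unset Strict Implicit.
Unset Printing Implicit Defensive.

(** Call a set of edges a [D]-twisted matching if it covers each vertex
    outside [D] exactly once and each vertex of [D] an even number of times,
    and join two such sets when they differ by the boundary of an inner
    face. Subdividing an edge and adding the new vertex to [D] does not
    change this graph, as the two halves of the edge are then used together
    or not at all. After an even number of subdivisions of a segment [P],
    the set [D] has an even number of vertices, all interior to the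
    connected set [P], so [P] contains a set [Q] of edges with odd degree
    exactly on [D]. Toggling [Q] preserves symmetric differences, and it
    turns twisted matchings into perfect matchings because the vertices on
    two edges of [P] have degree 2.

    This last fact is where planarity enters: otherwise, the third edge at
    such a vertex has the same face on both sides. But it is not a bridge,
    hence lies on a cycle, and Euler's formula implies that a cycle
    separates the faces into two classes. *)

Lemma set2_injr (T : finType) (x : T) : injective (fun y => [set x; y]).
Proof.
move=> y z E; have: y \in [set x; z] by rewrite -E set22.
rewrite in_set2 => /orP[]/eqP // yx; have: z \in [set x; y] by rewrite E set22.
by rewrite in_set2 yx orbb => /eqP.
Qed.

Lemma connect_homo_in (T U : finType) (S : {pred T}) (e : rel T) (e' : rel U)
    (h : T -> U) :
    {in S, forall x y, e x y -> y \in S /\ connect e' (h x) (h y)} ->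
  {in S, forall x y, connect e x y -> connect e' (h x) (h y)}.
Proof.
move=> e_h x xS y /connectP[p]; elim: p x xS => [|z p IHp] x xS /=.
  by move=> _ ->.
case/andP=> /(e_h x xS)[zS xz] zp Ey; exact: connect_trans xz (IHp z zS zp Ey).
Qed.

Lemma isomorphic_sym (G H : sgraph) : isomorphic G H -> isomorphic H G.
Proof.
case=> f [g fK gK] f_adj; exists g; first by exists f.
by move=> x y; rewrite -f_adj !gK.
Qed.

Lemma isomorphic_trans (G H K : sgraph) :
  isomorphic G H -> isomorphic H K -> isomorphic G K.
Proof.
case=> f f_bij f_adj [g g_bij g_adj]; exists (g \o f); first exact: bij_comp.
by move=> x y; rewrite /= g_adj f_adj.
Qed.

Section MatrixRows.
Import GRing.Theory.
Local Open Scope ring_scope.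

Lemma leq_rankS_ker_line (K : fieldType) m n (A : 'M[K]_(m, n)) (w : 'rV_m) :
    (forall r : 'rV_m, r *m A = 0 -> (r <= w)%MS) ->
  (m <= (\rank A).+1)%N.
Proof.
move=> kerA; rewrite -addn1 -leq_subLR -mxrank_ker.
apply: leq_trans (rank_leq_row w); apply/mxrankS/rV_subP=> r /sub_kermxP.
exact: kerA.
Qed.

Lemma row_enum_valP (R : nmodType) (T : finType) (A : {pred T})
    (r : 'rV[R]_#|A|) :
  exists c : T -> R, r = \row_i c (enum_val i).
Proof.
exists (fun a => \sum_(i | enum_val i == a) r 0 i); apply/rowP=> i; rewrite mxE.
by rewrite (big_pred1 i) // => j; rewrite (inj_eq enum_val_inj).
Qed.

End MatrixRows.

Section DartsAndEdges.
Variable G : sgraph.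
Implicit Types (d : G * G) (e : {set G}) (M N : {set {set G}}) (x y : G).

Definition darts : {set G * G} := [set d | adj d.1 d.2].

Definition rev_dart d : G * G := (d.2, d.1).

Definition dart_edge d : {set G} := [set d.1; d.2].

Lemma mem_darts x y : ((x, y) \in darts) = adj x y.
Proof. by rewrite inE. Qed.

Lemma rev_dartK : involutive rev_dart.
Proof. by case. Qed.

Lemma rev_dart_darts d : (rev_dart d \in darts) = (d \in darts).
Proof. by rewrite !inE adj_sym. Qed.

Lemma dart_neq d : d \in darts -> d.1 != d.2.
Proof. by rewrite inE; apply: contraTneq => ->; rewrite adj_irr. Qed.

Lemma dart_edge_rev d : dart_edge (rev_dart d) = dart_edge d.
Proof. exact: setUC. Qed.

Lemma dart_edgeP d d' :
  reflect (d = d' \/ d = rev_dart d') (dart_edge d == dart_edge d').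
Proof.
apply: (iffP eqP) => [|[]-> //]; last exact: dart_edge_rev.
case: d d' => [a b] [x y]; rewrite /dart_edge /= => E.
have: a \in [set x; y] by rewrite -E set21.
rewrite in_set2 => /orP[]/eqP Ea; subst a.
  by left; rewrite (set2_injr E).
by right; rewrite [RHS]setUC in E; rewrite /rev_dart (set2_injr E).
Qed.

Lemma edgesP e :
  reflect (exists2 d, d \in darts & e = dart_edge d) (e \in edges G).
Proof.
by apply: (iffP imsetP) => -[d dG ->]; exists d; rewrite // inE in dG *.
Qed.

Lemma mem_edges d : (dart_edge d \in edges G) = (d \in darts).
Proof.
apply/edgesP/idP => [[d' d'G /eqP/dart_edgeP[]->]|dG] //; last by exists d.
by rewrite rev_dart_darts.
Qed.

Lemma edges_adj x y : ([set x; y] \in edges G) = adj x y.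
Proof. by rewrite -mem_darts -mem_edges. Qed.

Lemma eq_edge_set M N : M \subset edges G -> N \subset edges G ->
  {in darts, forall d, (dart_edge d \in M) = (dart_edge d \in N)} -> M = N.
Proof.
move=> /subsetP MG /subsetP NG MN; apply/setP=> e.
case: (edgesP e) => [[d dG ->]|eG]; first exact: MN.
by apply/idP/idP => [/MG|/NG] /edgesP.
Qed.

Definition degree_in M x : nat := #|[set e in M | x \in e]|.

Lemma degree_in_neighbours M x : M \subset edges G ->
  degree_in M x = #|[set y | [set x; y] \in M]|.
Proof.
move/subsetP=> MG; rewrite -(card_imset _ (@set2_injr _ x)).
apply: eq_card => e; apply/idP/imsetP => [|[y]]; rewrite !inE; last first.
  by move=> xyM ->; rewrite xyM set21.
case/andP=> eM; have /edgesP[[a b] _ Ee] := MG _ eM; rewrite {}Ee in eM *.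
rewrite in_set2 => /orP[]/eqP->; first by exists b; rewrite // inE.
by exists a; rewrite ?inE setUC.
Qed.

Lemma degreeE x : degree x = degree_in (edges G) x.
Proof.
rewrite degree_in_neighbours //; apply: eq_card => y.
by rewrite !inE edges_adj.
Qed.

Lemma leq_degree_in M N x : M \subset N -> degree_in M x <= degree_in N x.
Proof.
move/subsetP=> MN; apply/subset_leq_card/subsetP => e; rewrite !inE.
by case/andP=> /MN->.
Qed.

Lemma degree_in_gt0 M x : (0 < degree_in M x) = (x \in cover M).
Proof.
by apply/card_gt0P/bigcupP => -[e]; [rewrite inE => /andP[] | ]; exists e;
  rewrite ?inE //; apply/andP.
Qed.

Lemma odd_degree_in M x :
  odd (degree_in M x) = \big[addb/false]_(e : {set G} | x \in e) (e \in M).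
Proof.
rewrite /degree_in -sum1dep_card (big_morph odd oddD (erefl _)) big_mkcond /=.
by rewrite [RHS]big_mkcond; apply: eq_bigr => e _; case: (e \in M); case: ifP.
Qed.

Lemma degree_in0 x : degree_in set0 x = 0.
Proof. by apply/eqP; rewrite cards_eq0; apply/eqP/setP=> e; rewrite !inE. Qed.

Lemma odd_degree_in_edge d x : d \in darts ->
  odd (degree_in [set dart_edge d] x) = (x == d.1) (+) (x == d.2).
Proof.
move/dart_neq=> d12; rewrite odd_degree_in big_mkcond (bigD1 (dart_edge d)) //=.
rewrite set11 big1 => [|e /negbTE e_d]; last by rewrite in_set1 e_d; case: ifP.
rewrite in_set2; case: (x =P d.1) => [->|_]; last by case: eqP.
by rewrite (negbTE d12).
Qed.

End DartsAndEdges.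

Section TJoins.
Variable G : embedded_graph.
Implicit Types (A B C P Q : {set {set G}}) (D : {set G}) (x y : G).

Lemma in_symdiff A B e : (e \in symdiff A B) = (e \in A) (+) (e \in B).
Proof. by rewrite !inE; case: (e \in A); case: (e \in B). Qed.

Lemma symdiffK B : involutive ((@symdiff G)^~ B).
Proof. by move=> A; apply/setP=> e; rewrite !in_symdiff addbK. Qed.

Lemma symdiff_cancel A B C : symdiff (symdiff A C) (symdiff B C) = symdiff A B.
Proof. by apply/setP=> e; rewrite !in_symdiff addbACA addbb addbF. Qed.

Lemma symdiff_subset A B C :
  A \subset C -> B \subset C -> symdiff A B \subset C.
Proof. by move=> AC BC; rewrite subUset !(subset_trans (subsetDl _ _)). Qed.

Lemma symdiff_subsetE A B C :
  B \subset C -> (symdiff A B \subset C) = (A \subset C).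
Proof.
move=> BC; apply/idP/idP => AC; last exact: symdiff_subset.
by rewrite -[A](symdiffK B) symdiff_subset.
Qed.

Lemma odd_degree_in_symdiff A B x :
  odd (degree_in (symdiff A B) x) = odd (degree_in A x) (+) odd (degree_in B x).
Proof.
by rewrite !odd_degree_in -big_split; apply: eq_bigr => e _; rewrite in_symdiff.
Qed.

Definition edge_rel P : rel G := [rel x y | [set x; y] \in P].

Lemma connect_edge_rel_sym P : connect_sym (edge_rel P).
Proof. by apply: sym_connect_sym => x y; rewrite /edge_rel /= setUC. Qed.

Lemma exists_path_tjoin P x y : P \subset edges G -> connect (edge_rel P) x y ->
  exists2 Q : {set {set G}}, Q \subset P &
    forall z, odd (degree_in Q z) = (z == x) (+) (z == y).
Proof.
move/subsetP=> PG /connectP[p]; elim: p x => [|a p IHp] x /=.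
  move=> _ ->; exists set0; rewrite ?sub0set // => z.
  by rewrite degree_in0 addbb.
case/andP=> xaP ap Ey; have [Q QP Q_odd] := IHp a ap Ey.
exists (symdiff [set dart_edge (x, a)] Q) => [|z].
  by rewrite symdiff_subset ?sub1set.
rewrite odd_degree_in_symdiff Q_odd odd_degree_in_edge.
  by rewrite addbA addbK.
by rewrite -mem_edges PG.
Qed.

Lemma exists_tjoin P D :
    P \subset edges G -> {in D &, forall x y, connect (edge_rel P) x y} ->
    ~~ odd #|D| ->
  exists2 Q : {set {set G}}, Q \subset P &
    forall x, odd (degree_in Q x) = (x \in D).
Proof.
move=> PG; have [n] := ubnP #|D|; elim: n D => // n IHn D leDn D_conn D_even.
have [->|[x xD]] := set_0Vmem D.
  by exists set0; rewrite ?sub0set // => x; rewrite degree_in0 in_set0.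
have [Dx|[y yDx]] := set_0Vmem (D :\ x).
  by rewrite (cardsD1 x) xD Dx cards0 in D_even.
have card_D := cardsD1 x D; rewrite xD (cardsD1 y (D :\ x)) yDx in card_D.
have [|||Q QP Q_odd] := IHn (D :\ x :\ y).
- by rewrite -ltnS (leq_trans _ leDn) // card_D.
- move=> a b /setD1P[_ /setD1P[_ aD]] /setD1P[_ /setD1P[_ bD]].
  exact: D_conn.
- by rewrite card_D /= negbK in D_even.
have /setD1P[yx yD] := yDx.
have [Q' Q'P Q'_odd] := exists_path_tjoin PG (D_conn x y xD yD).
exists (symdiff Q' Q) => [|z]; first exact: symdiff_subset.
rewrite odd_degree_in_symdiff Q_odd Q'_odd !in_setD1.
have [->|zx] := altP (z =P x); first by rewrite xD eq_sym (negbTE yx).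
by have [->|zy] := altP (z =P y); rewrite ?yD.
Qed.

End TJoins.

Section Faces.
Variable G : embedded_graph.
Implicit Types (d : G * G) (F : {set G * G}) (v x y : G).
Local Notation darts := (darts G).
Local Notation rot := (@Defs.rot G).

Lemma next_dart_darts d : d \in darts -> next_dart d \in darts.
Proof. by rewrite !inE => dG; apply: rot_adj; rewrite adj_sym. Qed.

Lemma iter_rot_adj v x n : adj v x -> adj v (iter n (rot v) x).
Proof. by move=> vx; elim: n => //= n; apply: rot_adj. Qed.

Lemma fconnect_rot v x : adj v x -> fconnect (rot v) x =i adj v.
Proof.
move=> vx y; apply/idP/idP => [/iter_findex<-|]; first exact: iter_rot_adj.
exact: rot_cyclic.
Qed.

Lemma order_rot v x : adj v x -> order (rot v) x = degree v.
Proof.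
by move/fconnect_rot=> rotx; rewrite /degree cardsE; apply: eq_card.
Qed.

Lemma rot_inj_in v : {in adj v &, injective (rot v)}.
Proof.
apply/imset_injP; rewrite eqn_leq leq_imset_card subset_leq_card //.
apply/subsetP=> x vx; have /iter_findex <- := rot_cyclic (rot_adj vx) vx.
by rewrite -iterSr iterS imset_f //; apply: iter_rot_adj.
Qed.

Lemma next_dart_inj_in : {in darts &, injective (@next_dart G)}.
Proof.
move=> [a b] [c d]; rewrite !mem_darts adj_sym [adj c d]adj_sym => ba dc [E].
by rewrite {}E in ba *; move/rot_inj_in=> -> //.
Qed.

Lemma imset_next_dart : @next_dart G @: darts = darts.
Proof.
apply/eqP; rewrite eqEcard (card_in_imset next_dart_inj_in) leqnn andbT.
by apply/subsetP=> _ /imsetP[d dG ->]; apply: next_dart_darts.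
Qed.

Lemma in_face_of d d' : (d' \in face_of d) = fconnect (@next_dart G) d d'.
Proof. by rewrite inE. Qed.

Lemma face_of_refl d : d \in face_of d.
Proof. by rewrite inE connect0. Qed.

Lemma next_dart_face_of d : next_dart d \in face_of d.
Proof. by rewrite in_face_of fconnect1. Qed.

Lemma face_of_darts d d' : d \in darts -> d' \in face_of d -> d' \in darts.
Proof.
rewrite in_face_of => dG /iter_findex <-.
by elim: (findex _ _ _) => //= n; apply: next_dart_darts.
Qed.

Lemma face_of_sym :
  {in darts &, forall d d', (d' \in face_of d) = (d \in face_of d')}.
Proof.
move=> d d' dG d'G; rewrite !in_face_of.
exact: (fconnect_sym_in next_dart_darts next_dart_inj_in).
Qed.

Lemma face_of_eq d d' :
  d \in darts -> d' \in face_of d -> face_of d' = face_of d.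
Proof.
move=> dG d'd; have d'G := face_of_darts dG d'd; have dd' := d'd.
rewrite face_of_sym // in dd'; rewrite !in_face_of in d'd dd'.
by apply/setP=> d''; rewrite !in_face_of; apply/idP/idP; apply: connect_trans.
Qed.

Lemma face_of_next d : d \in darts -> face_of (next_dart d) = face_of d.
Proof. by move=> dG; apply: face_of_eq; rewrite // next_dart_face_of. Qed.

Lemma face_of_corner v x : adj v x -> face_of (v, rot v x) = face_of (x, v).
Proof. by move=> vx; rewrite -[RHS]face_of_next // mem_darts adj_sym. Qed.

Lemma eq_face_of : {in darts &, forall d d',
  (face_of d' == face_of d) = (d' \in face_of d)}.
Proof.
move=> d d' dG d'G; apply/eqP/idP => [<-|/face_of_eq->] //; exact: face_of_refl.
Qed.

Lemma outer_dart_darts : outer_dart G \in darts.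
Proof. by rewrite inE; apply: outer_dart_adj. Qed.

Lemma facesP F :
  reflect (exists2 d, d \in darts & F = face_of d) (F \in faces G).
Proof.
by apply: (iffP imsetP) => -[d dG ->]; exists d; rewrite // inE in dG *.
Qed.

Lemma face_of_faces d : d \in darts -> face_of d \in faces G.
Proof. by move=> dG; apply/facesP; exists d. Qed.

Lemma mem_face F d : F \in faces G -> d \in F -> F = face_of d.
Proof. by case/facesP=> d0 d0G -> dF; rewrite (face_of_eq d0G). Qed.

Lemma face_edgesP F e :
  reflect (exists2 d, d \in F & e = dart_edge d) (e \in face_edges F).
Proof. exact: imsetP. Qed.

Lemma face_edges_subset F : F \in faces G -> face_edges F \subset edges G.
Proof.
case/facesP=> d dG ->; apply/subsetP=> e /face_edgesP[d' d'd ->].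
by rewrite mem_edges (face_of_darts dG d'd).
Qed.

Lemma mem_face_edges F d : F \in faces G -> dart_edge d \in face_edges F ->
  F = face_of d \/ F = face_of (rev_dart d).
Proof.
move=> FG /face_edgesP[d' /(mem_face FG)-> /eqP/dart_edgeP[]->]; first by left.
by right; rewrite rev_dartK.
Qed.

End Faces.

Section FaceColorings.
Variable G : embedded_graph.
Local Notation darts := (darts G).
Implicit Types (d : G * G) (F : {set G * G}) (e : {set G}) (x y : G).

Lemma face_coloring_constant (T : eqType) (c : {set G * G} -> T) :
    connected G ->
    {in darts, forall d, c (face_of (rev_dart d)) = c (face_of d)} ->
  {in faces G &, forall F1 F2, c F1 = c F2}.
Proof.
move=> G_conn c_rev _ _ /facesP[[a b] abG ->] /facesP[[x y] xyG ->].
have c_corner u v w : adj u v -> adj u w ->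
    c (face_of (u, v)) = c (face_of (u, w)).
  move=> uv uw; have /iter_findex <- := rot_cyclic uv uw.
  elim: (findex _ _ _) => //= n ->; have uvn := iter_rot_adj n uv.
  by rewrite face_of_corner // -(c_rev (u, _)) ?mem_darts.
pose C := [pred u | [forall v, adj u v ==>
                      (c (face_of (u, v)) == c (face_of (a, b)))]].
have C_face u v : adj u v -> u \in C -> c (face_of (u, v)) = c (face_of (a, b)).
  by move=> uv /forallP/(_ v)/implyP/(_ uv)/eqP.
have in_C u v : adj u v -> c (face_of (u, v)) = c (face_of (a, b)) -> u \in C.
  move=> uv c_uv; apply/forallP=> w; apply/implyP=> uw.
  by rewrite -c_uv; apply/eqP/c_corner.
have C_adj u v : adj u v -> u \in C -> v \in C.
  move=> uv uC; have vu : adj v u by rewrite adj_sym.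
  by apply: (in_C v u) => //; rewrite -(C_face u v) // -c_rev ?mem_darts.
have C_closed := intro_closed (sym_connect_sym (@adj_sym G)) C_adj.
rewrite !mem_darts in abG xyG; rewrite (C_face x y) //.
by rewrite -(closed_connect C_closed (G_conn a x)) (in_C a b).
Qed.

Import GRing.Theory.
Local Open Scope ring_scope.

(* [bool] serves as the field with two elements. *)
Definition incidence_mx : 'M[bool]_(#|edges G|, #|G|) :=
  \matrix_(i, j) (enum_val j \in (enum_val i : {set G})).

Definition face_boundary_mx : 'M[bool]_(#|faces G|, #|edges G|) :=
  \matrix_(i, j) \sum_(d in darts | dart_edge d == enum_val j)
                   (face_of d == enum_val i).

Lemma sum_dart_edge (h : G * G -> bool) d : d \in darts ->
  \sum_(d' in darts | dart_edge d' == dart_edge d) h d' = h d + h (rev_dart d).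
Proof.
move=> dG; have rev_d : rev_dart d != d.
  by case: d dG => x y /dart_neq; rewrite xpair_eqE eq_sym => /negbTE->.
rewrite (bigD1 d) ?eqxx ?andbT // (bigD1 (rev_dart d)) /=; last first.
  by rewrite rev_dart_darts dG dart_edge_rev eqxx.
rewrite big1 ?addr0 // => d'.
by case/andP=> /andP[/andP[_ /dart_edgeP[]->]]; rewrite eqxx.
Qed.

Lemma mul_row_face_boundary_mx (c : {set G * G} -> bool) :
  (\row_i c (enum_val i)) *m face_boundary_mx
  = \row_j \sum_(d in darts | dart_edge d == enum_val j) c (face_of d).
Proof.
apply/rowP=> j; rewrite !mxE; under eq_bigr do rewrite !mxE mulr_sumr.
rewrite exchange_big; apply: eq_bigr => d /andP[dG _] /=.
rewrite -(big_enum_val (fun F => c F * (face_of d == F))) /=.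
rewrite (bigD1 (face_of d)) ?face_of_faces //= eqxx mulr1 big1 ?addr0 // => F.
by case/andP=> _; rewrite eq_sym => /negbTE->; rewrite mulr0.
Qed.

Lemma mul_row_incidence_mx (Z : {set {set G}}) : Z \subset edges G ->
  (\row_i (enum_val i \in Z)) *m incidence_mx
  = \row_j odd (degree_in Z (enum_val j)).
Proof.
move/subsetP=> ZG; apply/rowP=> j; rewrite !mxE odd_degree_in.
under eq_bigr do rewrite !mxE.
rewrite -(big_enum_val (fun e => (e \in Z) * (enum_val j \in e))) /=.
rewrite big_mkcond [RHS]big_mkcond; apply: eq_bigr => e _.
case: (boolP (e \in Z)) => [/ZG->|_]; last by rewrite mul0r !if_same.
by rewrite mul1r; case: (enum_val j \in e).
Qed.

Lemma mul_face_boundary_incidence_mx : face_boundary_mx *m incidence_mx = 0.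
Proof.
apply/matrixP=> i k; rewrite !mxE; set x := enum_val k; set F := enum_val i.
transitivity (\sum_(d in darts) (face_of d == F) * (x \in dart_edge d)).
  rewrite (partition_big (@dart_edge G) (mem (edges G))) /= => [|d]; last first.
    by rewrite mem_edges.
  rewrite [RHS]big_enum_val; apply: eq_bigr => j _; rewrite !mxE mulr_suml.
  by apply: eq_bigr => d /andP[_ /eqP->].
transitivity (\sum_(d in darts)
    ((face_of d == F) * (d.1 == x) + (face_of d == F) * (d.2 == x))).
  apply: eq_bigr => d /dart_neq d12; rewrite -mulrDr in_set2 ![x == _]eq_sym.
  by case: (d.1 =P x) d12 => [->|_]; rewrite eq_sym; [move/negbTE->|case: eqP].
rewrite big_split /= -{1}imset_next_dart (big_imset _ (@next_dart_inj_in G)) /=.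
apply: etrans (addbb _); congr (_ (+) _).
by apply: eq_bigr => d dG; rewrite face_of_next.
Qed.

Lemma rank_face_boundary_mx : connected G ->
  (#|faces G| <= (\rank face_boundary_mx).+1)%N.
Proof.
move=> G_conn; apply: (@leq_rankS_ker_line _ _ _ _ (const_mx 1)) => r.
have [c ->] := row_enum_valP r; rewrite mul_row_face_boundary_mx => /rowP c_ker.
have c_const : {in faces G &, forall F1 F2, c F1 = c F2}.
  apply: face_coloring_constant => // d dG.
  have dE : dart_edge d \in edges G by rewrite mem_edges.
  have := c_ker (enum_rank_in dE (dart_edge d)).
  rewrite !mxE enum_rankK_in // sum_dart_edge //.
  by move/eqP; rewrite addr_eq0 => /eqP->.
apply/sub_rVP; exists (c (outer_face G)); apply/rowP=> i; rewrite !mxE mulr1.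
by apply: c_const; rewrite ?enum_valP // face_of_faces ?outer_dart_darts.
Qed.

Lemma rank_incidence_mx : connected G -> (#|G| <= (\rank incidence_mx).+1)%N.
Proof.
move=> G_conn; rewrite -mxrank_tr.
apply: (@leq_rankS_ker_line _ _ _ _ (const_mx 1)) => r.
have [c ->] := row_enum_valP r => /rowP c_ker.
have c_adj x y : adj x y -> c x = c y.
  move=> xy; have xyE : dart_edge (x, y) \in edges G by rewrite edges_adj.
  have := c_ker (enum_rank_in xyE (dart_edge (x, y))); rewrite !mxE.
  under eq_bigr do rewrite !mxE enum_rankK_in //.
  rewrite -(big_enum_val (fun z => c z * (z \in dart_edge (x, y)))) /=.
  have yx : y != x by rewrite eq_sym (@dart_neq _ (x, y)) ?mem_darts.
  rewrite (bigD1 x) // (bigD1 y) //= set21 set22 !mulr1 big1 ?addr0.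
    by move/eqP; rewrite addr_eq0 => /eqP.
  by move=> z /andP[zx zy]; rewrite in_set2 (negbTE zx) (negbTE zy) mulr0.
pose x0 := (outer_dart G).1; apply/sub_rVP; exists (c x0); apply/rowP=> i.
rewrite !mxE mulr1; apply/esym/eqP.
have c_closed : closed (@adj G) [pred x | c x0 == c x].
  by move=> x y xy; rewrite !inE (c_adj x y).
by have := closed_connect c_closed (G_conn x0 (enum_val i)); rewrite !inE eqxx.
Qed.

(* Euler's formula makes the two spaces equal in dimension. *)
Lemma ker_incidence_sub_face_boundary :
  plane G -> (kermx incidence_mx <= face_boundary_mx)%MS.
Proof.
case=> G_conn euler; have /sub_kermxP sub_ker := mul_face_boundary_incidence_mx.
rewrite -(geq_leqif (mxrank_leqif_sup sub_ker)) mxrank_ker leq_subLR.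
rewrite -(leq_add2r 2) -euler addn2 -addSn -addnS.
by rewrite leq_add ?rank_incidence_mx ?rank_face_boundary_mx.
Qed.

(* The Jordan curve theorem modulo 2. *)
Lemma even_edge_set_face_coloring (Z : {set {set G}}) :
    plane G -> Z \subset edges G -> (forall x, ~~ odd (degree_in Z x)) ->
  exists c : {set G * G} -> bool, {in darts, forall d,
    (dart_edge d \in Z) = c (face_of d) (+) c (face_of (rev_dart d))}.
Proof.
move=> planeG ZG Z_even.
have /sub_kermxP Z_ker : (\row_i (enum_val i \in Z)) *m incidence_mx = 0.
  rewrite mul_row_incidence_mx //; apply/rowP=> j.
  by rewrite !mxE (negbTE (Z_even _)).
have /submxP[r] := submx_trans Z_ker (ker_incidence_sub_face_boundary planeG).
have [c ->] := row_enum_valP r; rewrite mul_row_face_boundary_mx => /rowP Zc.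
exists c => d dG; have dE : dart_edge d \in edges G by rewrite mem_edges.
have := Zc (enum_rank_in dE (dart_edge d)).
by rewrite !mxE enum_rankK_in // sum_dart_edge.
Qed.

End FaceColorings.

Section CommonEdges.
Variable G : embedded_graph.
Local Notation darts := (darts G).
Local Notation rot := (@Defs.rot G).
Implicit Types (d : G * G) (F : {set G * G}) (x : G).

Definition bridge d : bool :=
  ~~ connect (edge_rel (edges G :\ dart_edge d)) d.1 d.2.

Lemma two_connected_bridgeless d :
  two_connected G -> d \in darts -> ~~ bridge d.
Proof.
case=> card3 _ G_conn2 dG; rewrite negbK; have d12 := dart_neq dG.
have avoid v : v \in dart_edge d ->
    subrel (connect [rel a b | [&& adj a b, a != v & b != v]])
           (connect (edge_rel (edges G :\ dart_edge d))).
  move=> vd; apply: connect_sub => a b /and3P[ab av bv]; apply: connect1.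
  rewrite /edge_rel /= in_setD1 edges_adj ab andbT.
  by apply: contraTneq vd => <-; rewrite in_set2 negb_or ![v == _]eq_sym av.
have /subsetPn[t _] : ~~ ([set: G] \subset dart_edge d).
  apply: contraL card3 => /subset_leq_card.
  by rewrite cardsT cards2 d12 -leqNgt.
rewrite in_set2 negb_or => /andP[t1 t2].
apply: connect_trans (avoid d.2 _ _ _ (G_conn2 _ d.1 t _ _)) _ => //.
  exact: set22.
by apply: (avoid d.1) (G_conn2 _ _ _ _ _); rewrite ?set21 // eq_sym.
Qed.

Lemma face_sides_neq d : plane G -> d \in darts -> ~~ bridge d ->
  face_of (rev_dart d) != face_of d.
Proof.
move=> planeG dG; rewrite negbK => d_conn.
have dE : dart_edge d \in edges G by rewrite mem_edges.
have [Q QE Q_odd] := exists_path_tjoin (subsetDl _ _) d_conn.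
pose Z := symdiff Q [set dart_edge d].
have [||c Zc] := @even_edge_set_face_coloring _ Z planeG.
- by rewrite symdiff_subset ?sub1set // (subset_trans QE) ?subsetDl.
- by move=> x; rewrite odd_degree_in_symdiff Q_odd odd_degree_in_edge // addbb.
have /negbTE dQ : dart_edge d \notin Q.
  by apply/negP => /(subsetP QE); rewrite in_setD1 eqxx.
have := Zc d dG; rewrite in_symdiff set11 dQ.
by apply: contra_eqN => /eqP->; rewrite addbb.
Qed.

Lemma common_edge_faces F1 F2 d :
    F1 \in faces G -> F2 \in faces G -> F1 != F2 ->
    dart_edge d \in face_edges F1 :&: face_edges F2 ->
  [set face_of d; face_of (rev_dart d)] = [set F1; F2].
Proof.
move=> F1G F2G F12 /setIP[/(mem_face_edges F1G) dF1 /(mem_face_edges F2G) dF2].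
by move: F12; case: dF1 => ->; case: dF2 => ->; rewrite ?eqxx // setUC.
Qed.

Lemma all_edges_but_one (M : {set {set G}}) x :
    M \subset edges G -> 0 < degree_in M x -> degree x <= (degree_in M x).+1 ->
  exists2 w, adj x w & forall t, adj x t -> t != w -> [set x; t] \in M.
Proof.
move=> /subsetP MG; rewrite degree_in_neighbours; last exact/subsetP.
set N := [set y | adj x y]; set NM := [set y | _] => NM0 degNM.
have NMN : NM \subset N.
  by apply/subsetP=> y; rewrite !inE -edges_adj; apply: MG.
have [N_NM|[w wN]] := set_0Vmem (N :\: NM).
  have /card_gt0P[w /(subsetP NMN)] := NM0; rewrite inE => xw.
  exists w => // t xt _.
  by move/eqP: N_NM; rewrite setD_eq0 => /subsetP/(_ t); rewrite !inE; apply.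
exists w => [|t xt]; first by move: wN; rewrite !inE => /andP[].
apply: contraNT => xtM; apply/eqP; suff diff1 : #|N :\: NM| <= 1.
  by apply: (card_le1_eqP diff1); rewrite // !inE xtM.
by rewrite cardsD (setIidPr NMN) leq_subLR addn1.
Qed.

(* At a vertex of degree 3 with two such edges, the faces met around the vertex
   alternate, so that the third edge has the same face on both sides. *)
Lemma degree_common_edges F1 F2 x : plane G -> two_connected G ->
    F1 \in faces G -> F2 \in faces G -> F1 != F2 ->
    1 < degree_in (face_edges F1 :&: face_edges F2) x ->
  degree x != 3.
Proof.
move=> planeG conn2G F1G F2G F12; set C := _ :&: _.
have CG : C \subset edges G by rewrite subIset ?face_edges_subset.
move=> C_degree; apply/eqP=> x_degree3.
have [|w xw w_only] := all_edges_but_one CG (ltnW C_degree).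
  by rewrite x_degree3.
have rot3 : iter 3 (rot x) w = w.
  rewrite -x_degree3 -(order_rot xw).
  by rewrite (iter_order_in (@rot_adj G x) (@rot_inj_in G x)).
have /= := orbit_uniq (rot x) w.
rewrite /orbit (order_rot xw) x_degree3 /= !inE !negb_or.
move: rot3 => /=; set y := rot x w; set z := rot x y => rotz.
case/and3P=> /andP[wy wz] _ _; have [xy xz] : adj x y /\ adj x z.
  by split; rewrite ?rot_adj.
have := common_edge_faces F1G F2G F12 (d := (x, y)) (w_only y xy _).
have := common_edge_faces F1G F2G F12 (d := (x, z)) (w_only z xz _).
rewrite /rev_dart /= -(face_of_corner xy) -(face_of_corner xz) rotz.
rewrite ![_ == w]eq_sym => <- // /(_ wy); rewrite setUC => /set2_injr face_xyw.
have xwG : (x, w) \in darts by rewrite mem_darts.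
have /negP[] := face_sides_neq planeG xwG (two_connected_bridgeless conn2G xwG).
by rewrite -[rev_dart _]/(w, x) -face_of_corner // face_xyw.
Qed.

End CommonEdges.

Section Segments.
Variable G : embedded_graph.
Implicit Types (P M Q : {set {set G}}) (D : {set G}) (x : G).

Record is_segment P : Prop := IsSegment {
  segment_edges : P \subset edges G;
  segment_degree : forall x, 1 < degree_in P x -> degree x <= 2;
  segment_connected : {in cover P &, forall x y, connect (edge_rel P) x y} }.

Lemma edge_component_subset P r : edge_component P r \subset P.
Proof. by apply/subsetP=> e; rewrite inE => /andP[]. Qed.

Lemma mem_edge_component P r x y : connect (edge_rel P) r x ->
  [set x; y] \in P -> [set x; y] \in edge_component P r.
Proof.
by move=> rx xyP; rewrite inE xyP; apply/existsP; exists x; rewrite set21.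
Qed.

Lemma edge_component_connect P r x : connect (edge_rel P) r x ->
  connect (edge_rel (edge_component P r)) r x.
Proof.
case/connectP=> p; elim/last_ind: p x => [|p b IHp] x /=; first by move=> _ ->.
rewrite rcons_path last_rcons => /andP[rp bP] ->.
apply: connect_trans (IHp _ rp erefl) _; apply: connect1.
by apply: mem_edge_component => //; apply/connectP; exists p.
Qed.

Lemma edge_component_connected P r : P \subset edges G ->
  {in cover (edge_component P r) &,
    forall x y, connect (edge_rel (edge_component P r)) x y}.
Proof.
move=> PG; suff from_r x : x \in cover (edge_component P r) ->
    connect (edge_rel (edge_component P r)) r x.
  move=> x y /from_r rx /from_r; apply: connect_trans.
  by rewrite connect_edge_rel_sym.
case/bigcupP=> e; rewrite inE => /andP[eP /existsP[y /andP[ye ry]]] xe.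
have ry' := edge_component_connect ry; apply: connect_trans ry' _.
have [-> //|xy] := eqVneq x y; apply: connect1; apply: mem_edge_component => //.
have /edgesP[d _ e_d] := subsetP PG e eP; suff -> : [set y; x] = e by [].
apply/eqP; rewrite eqEcard subUset !sub1set ye xe cards2 eq_sym xy e_d cards2.
by case: eqP.
Qed.

Lemma boundary_segment_is_segment P :
  even_ring_system G -> boundary_segment P -> is_segment P.
Proof.
case=> planeG _ conn2G deg3 deg23 [F FI]; set S := _ :&: _ => -[r _ ->].
have [F_outer FG] := setD1P FI.
have outerG := face_of_faces (outer_dart_darts G).
have SG : S \subset edges G by rewrite subIset ?face_edges_subset.
have PS := edge_component_subset S r.
split=> [|x P_degree|]; last exact: edge_component_connected.
  exact: subset_trans PS SG.
have S_degree := leq_trans P_degree (leq_degree_in x PS).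
have := degree_common_edges planeG conn2G FG outerG F_outer S_degree.
case: (boolP (boundary_vertex x)) => [/deg23|/deg3->] //.
by case=> ->.
Qed.

Definition twisted_matching D M : bool :=
  (M \subset edges G) &&
  [forall x, if x \in D then ~~ odd (degree_in M x) else degree_in M x == 1].

Lemma perfect_matchingE : @perfect_matching G =1 twisted_matching set0.
Proof.
by move=> M; congr (_ && _); apply: eq_forallb => x; rewrite in_set0.
Qed.

Lemma degree_in_symdiff0 M Q x : degree_in Q x = 0 ->
  degree_in (symdiff M Q) x = degree_in M x.
Proof.
move/eqP; rewrite cards_eq0 => /eqP Q0; apply: eq_card => e.
rewrite in_set in_symdiff [RHS]in_set.
have /setP/(_ e) := Q0; rewrite in_set in_set0.
by case: (x \in e); rewrite ?andbF // !andbT => ->; rewrite addbF.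
Qed.

Lemma degree_in_eq1 M x : M \subset edges G -> degree x <= 2 ->
  (degree_in M x == 1) = odd (degree_in M x).
Proof.
move/(leq_degree_in x); rewrite -degreeE => degM /(leq_trans degM).
by case: (degree_in M x) => [|[|[]]].
Qed.

(* Toggling a [D]-join contained in the segment corrects the parities. *)
Lemma segment_untwist P D : is_segment P ->
    {in D, forall x, 1 < degree_in P x} -> ~~ odd #|D| ->
  exists2 Q : {set {set G}}, Q \subset edges G &
    forall M, twisted_matching set0 (symdiff M Q) = twisted_matching D M.
Proof.
case=> PG P_degree P_conn DP D_even.
have [x y xD yD|Q QP Q_odd] := @exists_tjoin G P D PG _ D_even.
  by apply: P_conn; rewrite -degree_in_gt0 ltnW ?DP.
have QG := subset_trans QP PG; exists Q => // M.
rewrite /twisted_matching symdiff_subsetE //; apply: andb_id2l => MG.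
have MQG := symdiff_subset MG QG; apply: eq_forallb => x; rewrite in_set0.
have [Q0|Q_gt0] := posnP (degree_in Q x).
  by rewrite -(Q_odd x) Q0 /= degree_in_symdiff0.
have x_degree : degree x <= 2.
  apply: P_degree; case: (boolP (x \in D)) => [/DP //|xD].
  apply: leq_trans (leq_degree_in x QP).
  by have := Q_odd x; rewrite (negbTE xD); case: (degree_in Q x) Q_gt0 => [|[]].
rewrite !degree_in_eq1 // odd_degree_in_symdiff Q_odd.
by case: (x \in D); rewrite ?addbT ?addbF.
Qed.

End Segments.

Section FlipGraph.
Variable G : embedded_graph.
Implicit Types (Z M : {set {set G}}).

Definition inner_boundary Z : bool :=
  [exists F in inner_faces G, Z == face_edges F].

Lemma inner_boundaryP Z :
  reflect (exists d, [/\ d \in darts G, face_of d != outer_face G &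
                         Z = face_edges (face_of d)])
          (inner_boundary Z).
Proof.
apply: (iffP exists_inP) => [[F]|[d [dG d_outer ->]]].
  by case/setD1P=> F_outer /facesP[d dG Fd] /eqP->; exists d; rewrite -Fd.
by exists (face_of d) => //; apply/setD1P; split; rewrite ?face_of_faces.
Qed.

Variable p : pred {set {set G}}.

Definition flip_adj : rel {M : {set {set G}} | p M} :=
  [rel M1 M2 | inner_boundary (symdiff (val M1) (val M2))].

Lemma flip_sym : symmetric flip_adj.
Proof. by move=> M1 M2; rewrite /flip_adj /= /symdiff setUC. Qed.

Lemma flip_irr : irreflexive flip_adj.
Proof.
move=> M; apply/inner_boundaryP=> -[d [_ _ /setP/(_ (dart_edge d))]].
rewrite in_symdiff addbb => /esym/negP[].
by apply/face_edgesP; exists d; rewrite ?face_of_refl.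
Qed.

Definition flip_graph : sgraph := SGraph flip_sym flip_irr.

End FlipGraph.

Lemma flip_graph_isomorphic (G H : embedded_graph) (p : pred {set {set G}})
    (q : pred {set {set H}}) (phi : {set {set G}} -> {set {set H}}) :
    {homo phi : M / p M >-> q M} -> {in p &, injective phi} ->
    (forall N, q N -> exists2 M, p M & N = phi M) ->
    {in p &, forall M1 M2, inner_boundary (symdiff (phi M1) (phi M2))
                           = inner_boundary (symdiff M1 M2)} ->
  isomorphic (flip_graph p) (flip_graph q).
Proof.
move=> phi_q phi_inj phi_onto phi_flip.
pose f (M : flip_graph p) : flip_graph q :=
  Sub (phi (val M)) (phi_q _ (valP M)).
exists f => [|M1 M2]; last exact: phi_flip (valP M1) (valP M2).
apply: inj_card_bij => [M1 M2 /(congr1 val)|].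
  by move/(phi_inj _ _ (valP M1) (valP M2))/val_inj.
rewrite -[#|flip_graph p|]cardsT; apply: leq_trans (leq_imset_card f _).
rewrite -[#|flip_graph q|]cardsT; apply/subset_leq_card/subsetP=> N _.
have [M pM NM] := phi_onto _ (valP N); apply/imsetP.
by exists (Sub M pM : flip_graph p) => //; apply: val_inj.
Qed.

Definition twisted_resonance_graph (G : embedded_graph) (D : {set G}) :
    sgraph :=
  flip_graph (twisted_matching D).

Lemma resonance_graph_twisted (G : embedded_graph) :
  isomorphic (resonance_graph G) (twisted_resonance_graph (set0 : {set G})).
Proof.
apply: (@flip_graph_isomorphic G G (@perfect_matching G) _ id) => [M|||] //.
  by rewrite perfect_matchingE.
by move=> M; rewrite -perfect_matchingE; exists M.
Qed.

Lemma segment_untwist_isomorphic (G : embedded_graph) (P : {set {set G}})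
    (D : {set G}) :
    is_segment P -> {in D, forall x, 1 < degree_in P x} -> ~~ odd #|D| ->
  isomorphic (twisted_resonance_graph D)
             (twisted_resonance_graph (set0 : {set G})).
Proof.
move=> P_segment DP D_even.
have [Q QG untwist] := segment_untwist P_segment DP D_even.
apply: (flip_graph_isomorphic (phi := (@symdiff G)^~ Q)) => [M|||M1 M2 _ _].
- by rewrite untwist.
- by move=> M1 M2 _ _; apply: (can_inj (symdiffK Q)).
- move=> N; rewrite -{1}[N](symdiffK Q) untwist.
  by exists (symdiff N Q); rewrite ?symdiffK.
- by rewrite symdiff_cancel.
Qed.

(* The map [r] contracts paths of [H] to edges of [G], with section [s]. The
   next dart need only stay in its face, so [r] may reverse the orientation. *)
Record contraction (G H : embedded_graph) (r : H * H -> G * G)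
    (s : G * G -> H * H) : Prop := Contraction {
  contract_darts : {homo r : d / d \in darts H >-> d \in darts G};
  lift_darts : {homo s : d / d \in darts G >-> d \in darts H};
  contract_rev : {in darts H, {morph r : d / rev_dart d}};
  contract_next : {in darts H, forall d, r (next_dart d) \in face_of (r d)};
  lift_next : {in darts G, forall d, s (next_dart d) \in face_of (s d)};
  liftK : {in darts G, cancel s r};
  contractK : {in darts H, forall d, s (r d) \in face_of d};
  lift_outer : s (outer_dart G) \in outer_face H }.

Section Contraction.
Variables (G H : embedded_graph) (r : H * H -> G * G) (s : G * G -> H * H).
Hypothesis rs : contraction r s.
Implicit Types (M Z : {set {set G}}) (N : {set {set H}}).

Lemma contract_face_of :
  {in darts H &, forall d d', (r d' \in face_of (r d)) = (d' \in face_of d)}.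
Proof.
case: rs => r_dart s_dart _ r_next s_next _ sr _ d d' dH d'H.
apply/idP/idP; rewrite !in_face_of => dd'; last first.
  apply: (connect_homo_in (S := mem (darts H)) _ dH) dd' => a aH _ /eqP<-.
  by rewrite -in_face_of next_dart_darts ?r_next.
have : fconnect (@next_dart H) (s (r d)) (s (r d')).
  have rdG := r_dart _ dH.
  apply: (connect_homo_in (S := mem (darts G)) _ rdG) dd' => a aG _ /eqP<-.
  by rewrite -in_face_of next_dart_darts ?s_next.
rewrite -!in_face_of => /(face_of_eq (s_dart _ (r_dart _ dH))).
by rewrite (face_of_eq dH (sr d dH)) (face_of_eq d'H (sr d' d'H)) => <-;
  apply: face_of_refl.
Qed.

Lemma contract_outer : {in darts H, forall d,
  (face_of (r d) == outer_face G) = (face_of d == outer_face H)}.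
Proof.
case: (rs) => r_dart s_dart _ _ _ rK _ s_outer d dH.
have outerG := outer_dart_darts G; have s_outerH := s_dart _ outerG.
rewrite eq_face_of ?r_dart // -[X in face_of X]rK // contract_face_of //.
by rewrite -eq_face_of // (face_of_eq (outer_dart_darts H) s_outer).
Qed.

Definition pull M : {set {set H}} :=
  [set dart_edge d | d in darts H & dart_edge (r d) \in M].

Lemma mem_pull M d :
  d \in darts H -> (dart_edge d \in pull M) = (dart_edge (r d) \in M).
Proof.
move=> dH; apply/imsetP/idP => [[d']|rdM]; last by exists d; first exact/setIdP.
case/setIdP=> d'H rd'M /eqP/dart_edgeP[]-> //.
by rewrite (contract_rev rs) // dart_edge_rev.
Qed.

Lemma pull_subset M : pull M \subset edges H.
Proof. by apply/subsetP=> _ /imsetP[d /setIdP[dH _] ->]; rewrite mem_edges. Qed.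

Lemma pull_inj M1 M2 :
  M1 \subset edges G -> M2 \subset edges G -> pull M1 = pull M2 -> M1 = M2.
Proof.
move=> M1G M2G /setP pullE; apply: eq_edge_set => // d dG.
have sdH := lift_darts rs dG.
by have := pullE (dart_edge (s d)); rewrite !mem_pull // (liftK rs).
Qed.

Lemma pull_symdiff M1 M2 : pull (symdiff M1 M2) = symdiff (pull M1) (pull M2).
Proof.
apply: eq_edge_set => [||d dH]; rewrite ?symdiff_subset ?pull_subset //.
by rewrite in_symdiff !mem_pull // in_symdiff.
Qed.

Lemma face_edges_pull d : d \in darts H ->
  face_edges (face_of d) = pull (face_edges (face_of (r d))).
Proof.
move=> dH; have dF := face_of_faces dH.
apply: eq_edge_set => [||d' d'H]; rewrite ?pull_subset ?face_edges_subset //.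
rewrite mem_pull //; apply/face_edgesP/face_edgesP => -[d1 d1d].
  have d1H := face_of_darts dH d1d => /eqP/dart_edgeP[]->.
    by exists (r d1); rewrite ?contract_face_of.
  rewrite (contract_rev rs) // dart_edge_rev.
  by exists (r d1); rewrite ?contract_face_of.
case/eqP/dart_edgeP=> [rd'|rd']; [exists d' | exists (rev_dart d')] => //.
- by rewrite -contract_face_of // rd'.
- rewrite -contract_face_of ?rev_dart_darts // (contract_rev rs) // rd'.
  by rewrite rev_dartK.
- by rewrite dart_edge_rev.
Qed.

Lemma inner_boundary_pull Z :
  Z \subset edges G -> inner_boundary (pull Z) = inner_boundary Z.
Proof.
move=> ZG; apply/inner_boundaryP/inner_boundaryP => -[d [dD d_outer]].
  have rdG := contract_darts rs dD.
  have rd_sub := face_edges_subset (face_of_faces rdG).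
  rewrite face_edges_pull // => /(pull_inj ZG rd_sub)->.
  by exists (r d); rewrite contract_outer.
move=> ->; have sdH := lift_darts rs dD; exists (s d); split=> //.
  by rewrite -contract_outer // (liftK rs).
by rewrite face_edges_pull // (liftK rs).
Qed.

Lemma degree_in_pull M (x : G) (a : H) (h : G -> H) : M \subset edges G ->
    (forall b, adj a b -> exists2 y, adj x y & b = h y) ->
    (forall y, adj x y -> adj a (h y) /\ dart_edge (r (a, h y)) = [set x; y]) ->
  degree_in (pull M) a = degree_in M x.
Proof.
move=> MG h_onto h_edge; rewrite !degree_in_neighbours ?pull_subset //.
have M_adj y : [set x; y] \in M -> adj x y.
  by move/(subsetP MG); rewrite edges_adj.
rewrite -(card_in_imset (f := h)) => [|y z]; last first.
  rewrite !inE => /M_adj/h_edge[_ xy] /M_adj/h_edge[_ xz] hyz.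
  by apply: (@set2_injr _ x); rewrite -xy hyz.
apply: eq_card => b; rewrite inE; apply/idP/imsetP => [abM|[y]].
  have ab : adj a b by rewrite -edges_adj (subsetP (pull_subset M)).
  have [y xy b_y] := h_onto b ab; exists y => //; have [_ hy] := h_edge y xy.
  by move: abM; rewrite (mem_pull _ (d := (a, b))) ?mem_darts // b_y hy inE.
rewrite inE => xyM ->; have [ay hy] := h_edge y (M_adj y xyM).
by rewrite (mem_pull _ (d := (a, h y))) ?mem_darts // hy.
Qed.

Lemma fibre_constant_is_pull N : N \subset edges H ->
    {in darts H, forall d, (dart_edge (s (r d)) \in N) = (dart_edge d \in N)} ->
  exists2 M : {set {set G}}, M \subset edges G & N = pull M.
Proof.
move=> NH N_fibre.
exists [set dart_edge (r d) | d in darts H & dart_edge d \in N].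
  apply/subsetP=> _ /imsetP[d /setIdP[dH _] ->].
  by rewrite mem_edges (contract_darts rs).
apply: eq_edge_set; rewrite ?pull_subset // => d dH; rewrite mem_pull //.
apply/idP/imsetP => [dN|[d' /setIdP[d'H d'N]]].
  by exists d; first exact/setIdP.
rewrite -(N_fibre d) // => /eqP/dart_edgeP[]->; first by rewrite N_fibre.
by rewrite -(contract_rev rs) // N_fibre ?rev_dart_darts // dart_edge_rev.
Qed.

Lemma pull_twisted_isomorphic (D : {set G}) (D' : {set H}) :
    (forall M, M \subset edges G ->
      twisted_matching D' (pull M) = twisted_matching D M) ->
    (forall N, twisted_matching D' N ->
      {in darts H, forall d,
        (dart_edge (s (r d)) \in N) = (dart_edge d \in N)}) ->
  isomorphic (twisted_resonance_graph D) (twisted_resonance_graph D').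
Proof.
move=> pullD N_fibre.
have sub M : twisted_matching D M -> M \subset edges G by case/andP.
apply: (flip_graph_isomorphic (phi := pull)).
- by move=> M MD; rewrite pullD ?sub.
- by move=> M1 M2 /sub M1G /sub M2G; apply: pull_inj.
- move=> N ND'; have [NH _] := andP ND'.
  have [M MG NM] := fibre_constant_is_pull NH (N_fibre N ND').
  by exists M; rewrite // -pullD // -NM.
- move=> M1 M2 /sub M1G /sub M2G.
  by rewrite -pull_symdiff inner_boundary_pull ?symdiff_subset.
Qed.

End Contraction.

Section PlaneIsomorphism.
Variables (G H : embedded_graph) (f : G -> H) (f' : H -> G).
Local Notation rot := (@Defs.rot _).
Hypotheses (fK : cancel f f') (f'K : cancel f' f).
Hypothesis f_adj : forall x y : G, adj (f x) (f y) = adj x y.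

Let f'_adj x y : adj (f' x) (f' y) = adj x y.
Proof. by rewrite -f_adj !f'K. Qed.

Lemma contraction_isomorphic (r : H * H -> G * G) (s : G * G -> H * H) :
    contraction r s -> (forall d, dart_edge (r d) = [set f' d.1; f' d.2]) ->
    (forall d, s (r d) = d) ->
  isomorphic (twisted_resonance_graph (set0 : {set G}))
             (twisted_resonance_graph (set0 : {set H})).
Proof.
move=> rs r_edge rK.
apply: (pull_twisted_isomorphic rs) => [M MG|N _ d _]; last by rewrite rK.
rewrite /twisted_matching MG pull_subset.
have degM x : degree_in (pull r M) (f x) = degree_in M x.
  apply: (degree_in_pull rs) MG _ _ => [b|y xy].
    by rewrite -[b]f'K f_adj => xb; exists (f' b); rewrite ?f'K.
  by rewrite f_adj r_edge /= !fK.
apply/forallP/forallP => degM1 x; rewrite in_set0.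
  by have := degM1 (f x); rewrite in_set0 degM.
by have := degM1 (f' x); rewrite in_set0 -{2}(f'K x) degM.
Qed.

Lemma orientation_preserving_contraction :
    (forall x y : G, adj x y -> rot (f x) (f y) = f (rot x y)) ->
    (f (outer_dart G).1, f (outer_dart G).2) \in outer_face H ->
  contraction (fun d => (f' d.1, f' d.2)) (fun d => (f d.1, f d.2)).
Proof.
move=> f_rot f_outer; split=> //.
- by move=> d; rewrite !inE f'_adj.
- by move=> d; rewrite !inE f_adj.
- case=> x y; rewrite mem_darts adj_sym => yx.
  rewrite /next_dart /= (_ : f' (rot y x) = rot (f' y) (f' x)).
    exact: (next_dart_face_of (f' x, f' y)).
  by apply: (can_inj fK); rewrite -f_rot ?f'_adj // !f'K.
- case=> x y; rewrite mem_darts adj_sym => yx; rewrite /next_dart /= -f_rot //.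
  exact: (next_dart_face_of (f x, f y)).
- by move=> [x y] _; rewrite /= !fK.
- by move=> [x y] _; rewrite /= !f'K face_of_refl.
Qed.

Lemma orientation_reversing_contraction :
    (forall x y : G, adj x y -> rot (f x) (f (rot x y)) = f y) ->
    (f (outer_dart G).2, f (outer_dart G).1) \in outer_face H ->
  contraction (fun d => (f' d.2, f' d.1)) (fun d => (f d.2, f d.1)).
Proof.
move=> f_rot f_outer; split=> //.
- by move=> d; rewrite !inE f'_adj adj_sym.
- by move=> d; rewrite !inE f_adj adj_sym.
- case=> x y; rewrite mem_darts /next_dart /= => xy; set z := rot y x.
  have yx : adj y x by rewrite adj_sym.
  have yz : adj y z by apply: rot_adj.
  have rot_z : rot (f' y) (f' z) = f' x.
    have y_rot : adj y (f (rot (f' y) (f' z))).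
      by rewrite -{1}[y]f'K f_adj rot_adj ?f'_adj.
    apply: (can_inj fK); rewrite f'K; apply: (@rot_inj_in _ y) => //.
    by rewrite -{1}(f'K y) f_rot ?f'_adj // f'K.
  rewrite face_of_sym ?mem_darts ?f'_adj // 1?adj_sym //.
  by rewrite -[f' x]rot_z; apply: (next_dart_face_of (f' z, f' y)).
- case=> x y; rewrite mem_darts /next_dart /= => xy.
  have yx : adj y x by rewrite adj_sym.
  rewrite face_of_sym ?mem_darts ?f_adj ?rot_adj // 1?adj_sym ?rot_adj //.
  rewrite -[f x](f_rot y) //.
  exact: (next_dart_face_of (f (rot y x), f y)).
- by move=> [x y] _; rewrite /= !fK.
- by move=> [x y] _; rewrite /= !f'K face_of_refl.
Qed.

End PlaneIsomorphism.

Lemma plane_isomorphic_twisted_graphs (G H : embedded_graph) :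
    plane_isomorphic G H ->
  isomorphic (twisted_resonance_graph (set0 : {set G}))
             (twisted_resonance_graph (set0 : {set H})).
Proof.
case=> f [[f' fK f'K] f_adj [[f_rot f_outer]|[f_rot f_outer]]].
  apply: (contraction_isomorphic fK f'K f_adj) => [||d].
  - exact: orientation_preserving_contraction f_rot f_outer.
  - by [].
  - by case: d => x y; rewrite /= !f'K.
apply: (contraction_isomorphic fK f'K f_adj) => [|d|d].
- exact: orientation_reversing_contraction f_rot f_outer.
- exact: setUC.
- by case: d => x y; rewrite /= !f'K.
Qed.

Section Subdivision.
Variables (G : embedded_graph) (u v : G) (uv : adj u v).
Local Notation S := (subdivide uv).
Implicit Types (d : G * G) (x y : G) (M P : {set {set G}}) (D : {set G}).

Definition sub_dart d : S * S := (Some d.1, sub_head u v d.1 d.2).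

(* The value at [(None, None)], which is not a dart, is irrelevant. *)
Definition unsub_dart (d : S * S) : G * G :=
  match d with
  | (Some x, a) => (x, sub_unhead u v x a)
  | (None, Some y) => (sub_unhead u v y None, y)
  | (None, None) => (u, v)
  end.

Let vu_neq : (v == u) = false.
Proof. by rewrite eq_sym; apply/negbTE/(sub_neq uv). Qed.

Lemma cut_dart d : dart_edge d = [set u; v] -> d = (u, v) \/ d = (v, u).
Proof. by move/eqP/(dart_edgeP d (u, v)). Qed.

Lemma sub_dart_cut d :
  dart_edge d = [set u; v] -> sub_dart d = (Some d.1, None).
Proof. by move/eqP=> d_uv; rewrite /sub_dart /sub_head ifT. Qed.

Lemma sub_dart_uncut d : dart_edge d != [set u; v] ->
  sub_dart d = (Some d.1, Some d.2).
Proof. by move/negbTE=> d_uv; rewrite /sub_dart /sub_head ifF. Qed.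

Lemma next_sub_dart d : dart_edge d != [set u; v] ->
  next_dart (sub_dart d) = sub_dart (next_dart d).
Proof. by move=> d_uv; rewrite sub_dart_uncut. Qed.

Lemma next_sub_dart_cut d : dart_edge d = [set u; v] ->
  next_dart (sub_dart d) = (None, Some d.2).
Proof.
move=> d_uv; rewrite sub_dart_cut // /next_dart /=.
by case/cut_dart: d_uv => ->; rewrite /= ?eqxx // (inj_eq Some_inj) vu_neq.
Qed.

Lemma next2_sub_dart_cut d : dart_edge d = [set u; v] ->
  next_dart (next_dart (sub_dart d)) = sub_dart (next_dart d).
Proof.
move=> d_uv; rewrite next_sub_dart_cut // /next_dart /sub_dart /=.
by case/cut_dart: d_uv => ->; rewrite /= ?eqxx ?vu_neq.
Qed.

Variant sub_dart_spec : S * S -> Prop :=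
  | SubDart d of d \in darts G : sub_dart_spec (sub_dart d)
  | SubDartCut d of d \in darts G & dart_edge d = [set u; v] :
      sub_dart_spec (None, Some d.2).

Lemma sub_dartP (d : S * S) : d \in darts S -> sub_dart_spec d.
Proof.
case: d => [[x|] a]; rewrite mem_darts => /=.
  case/(sub_adj_head uv)=> y xy ->.
  by apply: (@SubDart (x, y)); rewrite mem_darts.
case: a => // y; rewrite /= in_set2 => /orP[]/eqP->.
  by apply: (@SubDartCut (v, u)); [rewrite mem_darts adj_sym | apply: setUC].
by apply: (@SubDartCut (u, v)); rewrite ?mem_darts.
Qed.

Lemma sub_dartK : cancel sub_dart unsub_dart.
Proof. by case=> x y; rewrite /= sub_headK. Qed.

Lemma unsub_dart_cut d :
  dart_edge d = [set u; v] -> unsub_dart (None, Some d.2) = d.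
Proof. by case/cut_dart=> ->; rewrite /= ?eqxx ?vu_neq. Qed.

Lemma sub_dart_darts d : d \in darts G -> sub_dart d \in darts S.
Proof. by rewrite !inE; apply: (sub_head_adj uv). Qed.

Lemma sub_dart_next_face d : d \in darts G ->
  sub_dart (next_dart d) \in face_of (sub_dart d).
Proof.
move=> dG; have sdS := sub_dart_darts dG.
have [d_uv|d_uv] := eqVneq (dart_edge d) [set u; v]; last first.
  by rewrite -next_sub_dart // next_dart_face_of.
by rewrite -next2_sub_dart_cut // -(face_of_next sdS) next_dart_face_of.
Qed.

Lemma unsub_dart_darts (d : S * S) : d \in darts S -> unsub_dart d \in darts G.
Proof. by case/sub_dartP=> {}d dG *; rewrite ?sub_dartK ?unsub_dart_cut. Qed.

Lemma unsub_dart_rev : {in darts S, {morph unsub_dart : d / rev_dart d}}.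
Proof.
move=> _ /sub_dartP[d dG|d dG d_uv]; last first.
  by rewrite unsub_dart_cut // -[RHS]sub_dartK sub_dart_cut // dart_edge_rev.
rewrite sub_dartK; have [d_uv|d_uv] := eqVneq (dart_edge d) [set u; v].
  by rewrite sub_dart_cut // -[RHS]unsub_dart_cut // dart_edge_rev.
by rewrite sub_dart_uncut.
Qed.

Lemma unsub_dart_next_face (d : S * S) : d \in darts S ->
  unsub_dart (next_dart d) \in face_of (unsub_dart d).
Proof.
case/sub_dartP=> {}d dG => [|d_uv]; last first.
  rewrite unsub_dart_cut // -next_sub_dart_cut // next2_sub_dart_cut //.
  by rewrite sub_dartK next_dart_face_of.
rewrite sub_dartK; have [d_uv|d_uv] := eqVneq (dart_edge d) [set u; v].
  by rewrite next_sub_dart_cut // unsub_dart_cut // face_of_refl.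
by rewrite next_sub_dart // sub_dartK next_dart_face_of.
Qed.

Lemma sub_unsub_dart_face (d : S * S) : d \in darts S ->
  sub_dart (unsub_dart d) \in face_of d.
Proof.
case/sub_dartP=> {}d dG => [|d_uv]; first by rewrite sub_dartK face_of_refl.
have sdS := sub_dart_darts dG.
by rewrite unsub_dart_cut // -next_sub_dart_cut // face_of_next ?face_of_refl.
Qed.

Lemma subdivide_contraction : contraction unsub_dart sub_dart.
Proof.
split.
- exact: unsub_dart_darts.
- exact: sub_dart_darts.
- exact: unsub_dart_rev.
- exact: unsub_dart_next_face.
- exact: sub_dart_next_face.
- by move=> d _; apply: sub_dartK.
- exact: sub_unsub_dart_face.
- exact: face_of_refl.
Qed.

Local Notation pull := (@pull G S unsub_dart).

Lemma mem_unsub_pull M (d : S * S) : d \in darts S ->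
  (dart_edge d \in pull M) = (dart_edge (unsub_dart d) \in M).
Proof. exact: (mem_pull subdivide_contraction). Qed.

Lemma degree_in_pull_Some M x : M \subset edges G ->
  degree_in (pull M) (Some x : S) = degree_in M x.
Proof.
move=> MG; pose h := sub_head u v x.
apply: (degree_in_pull subdivide_contraction (h := h)) => // [a|y xy].
  exact: (sub_adj_head uv).
split; first exact: (sub_head_adj uv).
by rewrite /dart_edge /= sub_headK.
Qed.

Lemma adj_sub_None (a : S) : adj (None : S) a = (a \in [set Some u; Some v]).
Proof. by case: a => [x|]; rewrite /= !inE. Qed.

Lemma mem_pull_None M (a : S) : adj (None : S) a ->
  ([set (None : S); a] \in pull M) = ([set u; v] \in M).
Proof.
move=> Na; rewrite (mem_unsub_pull _ (d := (None, a))) ?mem_darts //.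
move: Na; rewrite adj_sub_None in_set2 /dart_edge => /orP[]/eqP-> /=.
  by rewrite eqxx setUC.
by rewrite vu_neq.
Qed.

Lemma degree_sub_None : degree (None : S) = 2.
Proof.
rewrite /degree (_ : [set y | _] = [set Some u; Some v]).
  by rewrite cards2 (inj_eq Some_inj) (sub_neq uv).
by apply/setP=> a; rewrite in_set adj_sub_None.
Qed.

Lemma odd_degree_in_None (N : {set {set S}}) : N \subset edges S ->
  odd (degree_in N None)
  = ([set None; Some u] \in N) (+) ([set None; Some v] \in N).
Proof.
move=> NS; rewrite degree_in_neighbours // -sum1dep_card big_mkcond /=.
have uvS : Some u != Some v :> S by rewrite (inj_eq Some_inj) (sub_neq uv).
rewrite (bigD1 (Some u)) // (bigD1 (Some v)) /= 1?eq_sym //.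
rewrite big1 => [|a /andP[au av]]; first by do 2!case: ifP.
case: ifP => // /(subsetP NS).
by rewrite edges_adj adj_sub_None in_set2 (negbTE au) (negbTE av).
Qed.

Lemma pull_twisted D M : M \subset edges G ->
  twisted_matching (None |: (@Some G) @: D : {set S}) (pull M)
  = twisted_matching D M.
Proof.
move=> MG; rewrite /twisted_matching MG pull_subset.
have memD x : (Some x \in None |: (@Some G) @: D) = (x \in D).
  by rewrite in_setU1 /= mem_imset //; apply: Some_inj.
apply/forallP/forallP => /= M_degree.
  by move=> x; have := M_degree (Some x); rewrite memD degree_in_pull_Some.
case=> [x|]; first by rewrite memD degree_in_pull_Some.
rewrite setU11 odd_degree_in_None ?pull_subset //.
by rewrite !mem_pull_None ?addbb // adj_sub_None ?set21 ?set22.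
Qed.

Lemma twisted_fibre (D : {set S}) N : None \in D -> twisted_matching D N ->
  {in darts S, forall d : S * S,
    (dart_edge (sub_dart (unsub_dart d)) \in N) = (dart_edge d \in N)}.
Proof.
move=> ND /andP[NS /forallP/(_ None)].
rewrite ND odd_degree_in_None // => N_even.
move=> _ /sub_dartP[d dG|d dG d_uv]; first by rewrite sub_dartK.
rewrite unsub_dart_cut // sub_dart_cut // /dart_edge /= setUC.
by case/cut_dart: d_uv => -> /=; move: N_even; do 2!case: (_ \in N).
Qed.

Lemma subdivide_isomorphic D :
  isomorphic (twisted_resonance_graph D)
    (twisted_resonance_graph (None |: (@Some G) @: D : {set S})).
Proof.
apply: (pull_twisted_isomorphic subdivide_contraction) => [M|N].
  exact: pull_twisted.
by apply: twisted_fibre; rewrite setU11.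
Qed.

Lemma imset_Some_dart_edge d : dart_edge d != [set u; v] ->
  (@Some G) @: dart_edge d = dart_edge (sub_dart d).
Proof. by move=> d_uv; rewrite sub_dart_uncut // imsetU1 imset_set1. Qed.

Lemma dart_edge_sub_dart_cut d : dart_edge d = [set u; v] ->
  dart_edge (sub_dart d) \in [set [set Some u; None]; [set None; Some v]].
Proof.
move=> d_uv; rewrite sub_dart_cut // in_set2 /dart_edge.
by case/cut_dart: d_uv => -> /=; rewrite ?[[set Some v; _]]setUC eqxx ?orbT.
Qed.

Lemma sub_segmentE P : P \subset edges G -> [set u; v] \in P ->
  sub_segment uv P = pull P.
Proof.
move=> PG uvP; apply/setP=> e.
apply/setUP/idP => [[/imsetP[e0 /setD1P[]]|/set2P[]->]|eP].
- move=> e0_uv e0P ->; have /edgesP[d dG e0_d] := subsetP PG e0 e0P.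
  rewrite {}e0_d in e0_uv e0P *.
  by rewrite imset_Some_dart_edge // mem_unsub_pull ?sub_dart_darts ?sub_dartK.
- by rewrite setUC mem_pull_None // adj_sub_None set21.
- by rewrite mem_pull_None // adj_sub_None set22.
have /edgesP[d dS e_d] := subsetP (pull_subset _ _) e eP.
move: eP; rewrite {}e_d mem_unsub_pull //.
case/sub_dartP: dS => [{}d dG|{}d dG d_uv _].
  rewrite sub_dartK => dP.
  have [d_uv|d_uv] := eqVneq (dart_edge d) [set u; v]; [right|left].
    exact: dart_edge_sub_dart_cut.
  by rewrite -imset_Some_dart_edge //; apply: imset_f; apply/setD1P.
have rev_uv : dart_edge (rev_dart d) = [set u; v] by rewrite dart_edge_rev.
right; have := dart_edge_sub_dart_cut rev_uv.
by rewrite sub_dart_cut // -dart_edge_rev.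
Qed.

Lemma edge_rel_pull_None P x : [set u; v] \in P -> x \in [set u; v] ->
  edge_rel (pull P) None (Some x).
Proof. by move=> uvP x_uv; rewrite /edge_rel /= mem_pull_None. Qed.

Lemma connect_pull P x y : P \subset edges G -> connect (edge_rel P) x y ->
  connect (edge_rel (pull P)) (Some x) (Some y).
Proof.
move=> PG.
apply: (connect_homo_in (S := predT)) => // {}x _ {}y xyP; split=> //.
have [xy_uv|xy_uv] := eqVneq (dart_edge (x, y)) [set u; v].
  have uvP : [set u; v] \in P by rewrite -xy_uv.
  apply: (@connect_trans _ _ None).
    rewrite (@connect_edge_rel_sym S); apply/connect1/edge_rel_pull_None => //.
    by rewrite -xy_uv set21.
  by apply/connect1/edge_rel_pull_None; rewrite // -xy_uv set22.
have xyG : (x, y) \in darts G by rewrite -mem_edges (subsetP PG).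
apply: connect1; suff : dart_edge (sub_dart (x, y)) \in pull P.
  by rewrite sub_dart_uncut.
by rewrite mem_unsub_pull ?sub_dart_darts // sub_dartK.
Qed.

Lemma pull_is_segment P :
  [set u; v] \in P -> is_segment P -> is_segment (pull P).
Proof.
move=> uvP [PG P_degree P_conn]; split; first exact: pull_subset.
  case=> [x|]; last by rewrite degree_sub_None.
  rewrite degree_in_pull_Some // => /P_degree.
  rewrite !degreeE (_ : edges S = pull (edges G)) ?degree_in_pull_Some //.
  apply: eq_edge_set; rewrite ?pull_subset // => d dS; rewrite mem_edges dS.
  by rewrite mem_unsub_pull // mem_edges unsub_dart_darts.
have connect_Some a : a \in cover (pull P) ->
    exists2 x, x \in cover P & connect (edge_rel (pull P)) a (Some x).
  case: a => [x|_].
    by rewrite -degree_in_gt0 degree_in_pull_Some // degree_in_gt0; exists x.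
  exists u; first by apply/bigcupP; exists [set u; v]; rewrite // set21.
  by apply/connect1/edge_rel_pull_None; rewrite ?set21.
move=> a b /connect_Some[x xP ax] /connect_Some[y yP].
rewrite connect_edge_rel_sym; apply: connect_trans; apply: connect_trans ax _.
exact: connect_pull PG (P_conn x y xP yP).
Qed.

Lemma degree_in_pull_None P : [set u; v] \in P -> 1 < degree_in (pull P) None.
Proof.
move=> uvP; rewrite degree_in_neighbours ?pull_subset // -degree_sub_None.
apply/subset_leq_card/subsetP=> a; rewrite !in_set => Na.
by rewrite mem_pull_None.
Qed.

End Subdivision.

Lemma subdivided_isomorphic (G H : embedded_graph) (P : {set {set G}}) n
    (D : {set G}) :
    subdivided P n H -> is_segment P -> {in D, forall x, 1 < degree_in P x} ->
    ~~ odd (n + #|D|) ->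
  isomorphic (twisted_resonance_graph D)
             (twisted_resonance_graph (set0 : {set H})).
Proof.
move=> GH; elim: GH D => {G P n H} [G P H GH|G P n H u v uv uvP _ IH] D.
  move=> P_segment DP D_even.
  apply: isomorphic_trans (plane_isomorphic_twisted_graphs GH).
  exact: segment_untwist_isomorphic P_segment DP D_even.
move=> P_segment DP D_even; have PG := segment_edges P_segment.
apply: isomorphic_trans (subdivide_isomorphic uv D) _.
apply: IH; rewrite ?sub_segmentE //; first exact: pull_is_segment.
  move=> a /setU1P[->|/imsetP[x xD ->]]; first exact: degree_in_pull_None.
  by rewrite degree_in_pull_Some ?DP.
rewrite cardsU1 (card_imset _ (@Some_inj _)).
rewrite (_ : None \notin _) ?addnA ?addn1 //.
by apply/imsetP=> -[].
Qed.

Lemma segment_subdivision_isomorphic (G H : embedded_graph) :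
    even_ring_system G -> segment_subdivision G H ->
  isomorphic (resonance_graph G) (resonance_graph H).
Proof.
move=> ersG [P [n [P_boundary n_even GH]]].
apply: isomorphic_trans (resonance_graph_twisted G) _.
apply: isomorphic_trans (isomorphic_sym (resonance_graph_twisted H)).
apply: (subdivided_isomorphic GH); first exact: boundary_segment_is_segment.
  by move=> x; rewrite in_set0.
by rewrite cards0 addn0.
Qed.

Theorem theorem4p4 (G H : embedded_graph) (cersG : cers G) (cersH : cers H) :
  resonantly_equivalent G H ->
  isomorphic (resonance_graph G) (resonance_graph H).
Proof.
move=> GH; apply: isomorphic_sym; elim: GH {cersG cersH} => {G H}.
- move=> G H [[ersG _] [ersH _] [GH|HG]].
    exact: segment_subdivision_isomorphic.
  exact/isomorphic_sym/segment_subdivision_isomorphic.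
- by move=> G; exists id => //; exists id.
- by move=> G H K _ GH _ HK; apply: isomorphic_trans GH HK.
Qed.
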